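(* Let $d\in\mathbb N$, $\boldsymbol\omega\in\mathbb R_+^d$, $\ell\in\mathbb N$, and in each direction $1\le j\le d$ let the domain, sites, kernels, coefficient vectors and matrices be as in the context. Let $\mathcal A_{\mathcal I_{\boldsymbol\omega}(\ell,d)}$ be the tensor product multilevel approximation operator defined in the context. Then for every $\boldsymbol f\in C(\Omega^{\otimes})$ and every $\boldsymbol x=(\boldsymbol x^{(1)},\dots,\boldsymbol x^{(d)})\in\Omega^{(1)}\times\cdots\times\Omega^{(d)}$, $$\mathcal A_{\mathcal I_{\boldsymbol\omega}(\ell,d)}(\boldsymbol f)(\boldsymbol x)=\sum_{\boldsymbol\lambda\in\mathcal J_{\boldsymbol\omega}(\ell,d)}\ \sum_{\substack{\boldsymbol\beta\in\{0,1\}^d\\ \boldsymbol\lambda+\boldsymbol\beta\in\mathcal I_{\boldsymbol\omega}(\ell,d)}}(-1)^{\|\boldsymbol\beta\|_1+d}\sum_{u_1^{(1)}=1}^{\lambda_1}\cdots\sum_{u_1^{(d)}=1}^{\lambda_d}\ \sum_{k_1^{(1)}=1}^{N^{(1)}_{u_1^{(1)}}}\cdots\sum_{k_1^{(d)}=1}^{N^{(d)}_{u_1^{(d)}}}\boldsymbol f(\boldsymbol x_{\boldsymbol u_1,\boldsymbol k_1})\prod_{j=1}^d\ \sum_{m=u_1^{(j)}}^{\lambda_j}\left(\boldsymbol\xi^{(j)}_{u_1^{(j)},m}(\boldsymbol x^{(j)})\right)_{k_1^{(j)}},$$ where $\boldsymbol x_{\boldsymbol u_1,\boldsymbol k_1}=(\boldsymbol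 x^{(1)}_{u_1^{(1)},k_1^{(1)}},\dots,\boldsymbol x^{(d)}_{u_1^{(d)},k_1^{(d)}})$ and $(\cdot)_{k}$ denotes the $k$-th entry of a vector.
   Context: $\mathbb N=\{1,2,\dots\}$. Index sets. For $\boldsymbol\omega\in\mathbb R_+^d$ (positive entries), $\omega_{min}=\min_j\omega_j$ and a real threshold $t$, $\mathcal I_{\boldsymbol\omega}(t,d)=\{\boldsymbol\lambda\in\mathbb N^d:\sum_{j=1}^d(\lambda_j-1)\omega_j\le t\,\omega_{min}\}$. For $\ell\in\mathbb N$, $\mathcal J_{\boldsymbol\omega}(\ell,d)=\mathcal I_{\boldsymbol\omega}(\ell,d)\setminus\mathcal I_{\boldsymbol\omega}(\ell-\|\boldsymbol\omega\|_1/\omega_{min},d)$. The largest level in direction $j$ is $\lambda_{j,max}=\lfloor \ell\omega_{min}/\omega_j\rfloor+1$. Directions. For $1\le j\le d$: $\Omega^{(j)}\subseteq\mathbb R^{n_j}$, $n_j\in\mathbb N$; $\Omega^{\otimes}=\Omega^{(1)}\times\cdots\times\Omega^{(d)}$. For each level $1\le i\le\lambda_{j,max}$: a finite set of distinct sites $X_i^{(j)}=\{\boldsymbol x^{(j)}_{i,1},\dots,\boldsymbol x^{(j)}_{i,N_i^{(j)}}\}\subset\Omega^{(j)}$, a compactly supported kernel $\Phi_i^{(j)}:\mathbb R^{n_j}\to\mathbb R$, the vector function $\boldsymbol r_i^{(j)}=(\Phi_i^{(j)}(\cdot-\boldsymbol x^{(j)}_{i,1}),\dots,\Phi_i^{(j)}(\cdot-\boldsymbol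 x^{(j)}_{i,N_i^{(j)}}))^{T}$ with values in $\mathbb R^{N_i^{(j)}}$, the Gram matrix $M_i^{(j)}=(\Phi_i^{(j)}(\boldsymbol x^{(j)}_{i,k}-\boldsymbol x^{(j)}_{i,m}))_{k,m}$, the coefficient vectors $\boldsymbol\alpha^{(j)}_{i,k}=(M_i^{(j)})^{-1}\boldsymbol e_k$ (interpolation) or $\boldsymbol\alpha^{(j)}_{i,k}=(M_i^{(j)}+\lambda_i^{(j)}I)^{-1}\boldsymbol e_k$ (penalized least squares, with regularization parameter $\lambda_i^{(j)}$), the inverted matrices being assumed invertible, and the (generalized) Lagrange functions $\chi^{(j)}_{i,k}=(\boldsymbol\alpha^{(j)}_{i,k})^{T}\boldsymbol r_i^{(j)}$. Ordered sets. An ordered set is $\mathfrak u=\{u_1,\dots,u_{\#\mathfrak u}\}\subseteq\{1,\dots,L\}$ with $u_1<\cdots<u_{\#\mathfrak u}$. In direction $j$, $\boldsymbol N_{\mathfrak u}=(N^{(j)}_{u_1},\dots,N^{(j)}_{u_{\#\mathfrak u}})$, and $\sum_{\boldsymbol k\le\boldsymbol N_{\mathfrak u}}$ denotes the sum over all $\boldsymbol k=(k_1,\dots,k_{\#\mathfrak u})$ with $1\le k_m\le N^{(j)}_{u_m}$. Set $a^{(j)}(\mathfrak u,\boldsymbol k)=\prod_{m=1}^{\#\mathfrak u-1}\chi^{(j)}_{u_m,k_m}(\boldsymbol x^{(j)}_{u_{m+1},k_{m+1}})$, which is $1$ if $\#\mathfrak u=1$. Tensor product multilevel approximation. For $\boldsymbol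 f\in C(\Omega^{\otimes})$, $\boldsymbol x\in\Omega^{\otimes}$, $$\mathcal A_{\mathcal I_{\boldsymbol\omega}(\ell,d)}(\boldsymbol f)(\boldsymbol x)=\sum_{\boldsymbol\lambda\in\mathcal J_{\boldsymbol\omega}(\ell,d)}\sum_{\substack{\boldsymbol\beta\in\{0,1\}^d\\ \boldsymbol\lambda+\boldsymbol\beta\in\mathcal I_{\boldsymbol\omega}(\ell,d)}}\sum_{\emptyset\ne\mathfrak u^{(1)}\subseteq\{1,\dots,\lambda_1\}}\cdots\sum_{\emptyset\ne\mathfrak u^{(d)}\subseteq\{1,\dots,\lambda_d\}}(-1)^{\|\boldsymbol\beta\|_1+d+\#\mathfrak u^{(1)}+\cdots+\#\mathfrak u^{(d)}}$$ $$\cdot\sum_{\boldsymbol k^{(1)}\le\boldsymbol N_{\mathfrak u^{(1)}}}\cdots\sum_{\boldsymbol k^{(d)}\le\boldsymbol N_{\mathfrak u^{(d)}}}\boldsymbol f(\boldsymbol x^{(1)}_{u_1^{(1)},k_1^{(1)}},\dots,\boldsymbol x^{(d)}_{u_1^{(d)},k_1^{(d)}})\prod_{j=1}^d a^{(j)}(\mathfrak u^{(j)},\boldsymbol k^{(j)})\prod_{j=1}^d\chi^{(j)}_{u^{(j)}_{\#\mathfrak u^{(j)}},k^{(j)}_{\#\mathfrak u^{(j)}}}(\boldsymbol x^{(j)}).$$ Matrices. For an ordered set $\mathfrak u\subseteq\{1,\dots,\lambda_{j,max}\}$, $\mathfrak u\neq\emptyset$, $$P^{(j)}_{\mathfrak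 u}=\prod_{m=2}^{\#\mathfrak u}\ \sum_{k_m\le N^{(j)}_{u_m}}\boldsymbol r^{(j)}_{u_{m-1}}(\boldsymbol x^{(j)}_{u_m,k_m})(\boldsymbol\alpha^{(j)}_{u_m,k_m})^{T}\in\mathbb R^{N^{(j)}_{u_1}\times N^{(j)}_{u_{\#\mathfrak u}}},$$ the matrix product being taken from left to right in increasing $m$, and the empty product ($\#\mathfrak u=1$) being the identity. For $1\le m\le p\le\lambda_{j,max}$, $$S^{(j)}_{m,p}=\sum_{\mathfrak u}(-1)^{\#\mathfrak u}P^{(j)}_{\mathfrak u}\in\mathbb R^{N^{(j)}_m\times N^{(j)}_p},$$ the sum being over all ordered sets $\mathfrak u\subseteq\{1,\dots,\lambda_{j,max}\}$ with first (smallest) element $m$ and last (largest) element $p$. Let $A^{(j)}_i\in\mathbb R^{N_i^{(j)}\times N_i^{(j)}}$ be the matrix whose $k$-th row is $(\boldsymbol\alpha^{(j)}_{i,k})^{T}$. For $1\le i\le m\le\lambda_{j,max}$ and $\boldsymbol x^{(j)}\in\Omega^{(j)}$, $$\boldsymbol\xi^{(j)}_{i,m}(\boldsymbol x^{(j)})=A^{(j)}_i\,S^{(j)}_{i,m}\,\boldsymbol r^{(j)}_m(\boldsymbol x^{(j)})\in\mathbb R^{N_i^{(j)}}$$ (the $(i,m)$ block of the product of $\mathrm{diag}(A_1^{(j)},\dots,A^{(j)}_{\lambda_{j,max}})$, the block upper triangular matrix $(S^{(j)}_{i,m})_{i\le m}$, and $\mathrm{diag}(\boldsymbol r_1^{(j)}(\boldsymbol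 x^{(j)}),\dots,\boldsymbol r^{(j)}_{\lambda_{j,max}}(\boldsymbol x^{(j)}))$). *)

(* Defs.v *)
From HB Require Import structures.
From mathcomp Require Import all_boot all_order all_algebra.
From mathcomp Require Import all_classical all_reals all_analysis.
Set Implicit Arguments.
Unset Strict Implicit.
Unset Printing Implicit Defensive.
Import Order.TTheory GRing.Theory Num.Theory.
Import numFieldNormedType.Exports.
Local Open Scope classical_set_scope.
Local Open Scope ring_scope.

Section IndexSets.
Context {R : realType} {d : nat}.
Variables (hd : (0 < d)%N) (omega : 'I_d -> R).

Definition omega_min : R := \big[Num.min/omega (Ordinal hd)]_(j < d) omega j.

Definition index_set (t : R) : set {ffun 'I_d -> nat} :=
  [set lam | (forall j, (0 < lam j)%N) /\
    \sum_(j < d) ((lam j)%:R - 1) * omega j <= t * omega_min].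

Definition surplus_set (l : nat) : set {ffun 'I_d -> nat} :=
  index_set l%:R `\`
  index_set (l%:R - (\sum_(j < d) `|omega j|) / omega_min).

(* [Num.truncn] is the nat-valued floor; its argument is positive when the
   weights are. *)
Definition level_max (l : nat) (j : 'I_d) : nat :=
  (Num.truncn (l%:R * omega_min / omega j)).+1.

(* Weights are positive, so these sets are finite and the [fsbigop] sums below,
   which range over them, are genuine finite sums. *)
Lemma finite_index_set t : (forall j, 0 < omega j) -> finite_set (index_set t).
Proof.
move=> om0.
pose B := (\max_(j < d) Num.truncn (t * omega_min / omega j)).+2.
pose g (h : {ffun 'I_d -> 'I_B}) : {ffun 'I_d -> nat} := [ffun j => h j : nat].
apply: (@sub_finite_set _ _ (range g)); last first.
  exact: finite_image.
move=> lam [lam0 lam_le].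
have ltB j : (lam j < B)%N.
  rewrite /B ltnS; case E : (lam j) => [//|p].
  rewrite ltnS; apply: leq_trans (leq_bigmax j).
  have term_ge0 i : 0 <= ((lam i)%:R - 1) * omega i.
    by apply: mulr_ge0; rewrite ?subr_ge0 ?ler1n ?(ltW (om0 i)).
  have le1 : p%:R * omega j <= t * omega_min.
    apply: le_trans lam_le; rewrite (bigD1 j)//= E -natr1 addrK lerDl.
    exact: sumr_ge0.
  have le2 : p%:R <= t * omega_min / omega j by rewrite ler_pdivlMr.
  by rewrite truncn_ge_nat// (le_trans _ le2).
exists [ffun j => Ordinal (ltB j)] => //.
by apply/ffunP => j; rewrite !ffunE.
Qed.

Lemma finite_surplus_set l :
  (forall j, 0 < omega j) -> finite_set (surplus_set l).
Proof. by move=> om0; apply/finite_setD/finite_index_set. Qed.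

End IndexSets.

Inductive scheme (R : Type) := Interpolation | PenalizedLS of R.
Arguments Interpolation {R}.

(* Levels are natural numbers starting at 1; only the data of the levels
   1, ..., level_max are constrained and used. *)
Record direction (R : realType) := Direction {
  dim : nat;
  domain : set 'rV[R]_dim;
  nsites : nat -> nat;
  site : forall i : nat, 'I_(nsites i) -> 'rV[R]_dim;
  kernel : nat -> 'rV[R]_dim -> R;
  method : nat -> scheme R
}.
Arguments domain {R} d _.
Arguments site {R d i} _.
Arguments kernel {R} d _ _.

Section Direction.
Context {R : realType}.
Variable D : direction R.

Definition rvec (i : nat) (y : 'rV[R]_(dim D)) : 'cV[R]_(nsites D i) :=
  \col_k kernel D i (y - site k).

Definition gram (i : nat) : 'M[R]_(nsites D i) :=
  \matrix_(k, m) kernel D i (site k - site m).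

Definition system_mx (i : nat) : 'M[R]_(nsites D i) :=
  match method D i with
  | Interpolation => gram i
  | PenalizedLS reg => gram i + reg%:M
  end.

Definition alpha (i : nat) (k : 'I_(nsites D i)) : 'cV[R]_(nsites D i) :=
  invmx (system_mx i) *m delta_mx k 0.

Definition chi (i : nat) (k : 'I_(nsites D i)) (y : 'rV[R]_(dim D)) : R :=
  ((alpha k)^T *m rvec i y) 0 0.

Definition admissible (L : nat) : Prop :=
  (0 < dim D)%N /\
  forall i : nat, (1 <= i <= L)%N ->
    [/\ injective (@site R D i),
        forall k : 'I_(nsites D i), domain D (site k),
        compact (closure [set y | kernel D i y != 0]) &
        system_mx i \in unitmx].

(* An ordered set of levels in {1, ..., L} is a u : {set 'I_L}, the ordinal p
   standing for the level p + 1.  [enum u] is increasing, so [lev u m] is the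
   level u_{m+1}: positions are counted from 0, levels from 1. *)
Definition lev (L : nat) (u : {set 'I_L}) (m : nat) : nat :=
  nth 0%N [seq (val p).+1 | p <- enum u] m.

(* Multi-indices k <= N_u.  The bound #|u|.-1.+1 equals #|u| for the nonempty
   sets in use, and makes the first and last positions available as [ord0] and
   [ord_max]. *)
Definition multi_index (L : nat) (u : {set 'I_L}) : finType :=
  {dffun forall m : 'I_(#|u|.-1.+1), 'I_(nsites D (lev u m))}.

Definition acoef (L : nat) (u : {set 'I_L}) (k : multi_index u) : R :=
  \prod_(m < #|u|.-1)
    chi (k (widen_ord (leqnSn _) m)) (site (k (lift ord0 m))).

Definition transfer_mx (i p : nat) : 'M[R]_(nsites D i, nsites D p) :=
  \sum_(k < nsites D p) rvec i (site k) *m (alpha k)^T.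

(* Left-to-right product B_0 *m B_1 *m ... *m B_(n-1) of matrices with
   varying dimensions. *)
Fixpoint mulmx_seq (s : nat -> nat) (B : forall m, 'M[R]_(s m, s m.+1))
    (n : nat) : 'M[R]_(s 0%N, s n) :=
  if n is n'.+1 then mulmx_seq B n' *m B n' else 1%:M.

Definition path_mx (L : nat) (u : {set 'I_L}) :
    'M[R]_(nsites D (lev u 0), nsites D (lev u #|u|.-1)) :=
  mulmx_seq (s := fun m => nsites D (lev u m))
    (fun m => transfer_mx (lev u m) (lev u m.+1)) #|u|.-1.

(* [conform_mx 0] only transports [path_mx u] along the equations
   lev u 0 = m and lev u #|u|.-1 = p guaranteed by the range of the sum. *)
Definition Smx (L m p : nat) : 'M[R]_(nsites D m, nsites D p) :=
  \sum_(u : {set 'I_L} |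
        [&& u != finset.set0, lev u 0 == m & lev u #|u|.-1 == p])
    (-1) ^+ #|u| *: conform_mx 0 (path_mx u).

Definition alpha_mx (i : nat) : 'M[R]_(nsites D i) := \matrix_k (alpha k)^T.

Definition xi (L i m : nat) (y : 'rV[R]_(dim D)) : 'cV[R]_(nsites D i) :=
  alpha_mx i *m Smx L i m *m rvec m y.

End Direction.

Section Operator.
Context {R : realType} {d : nat}.
Variables (hd : (0 < d)%N) (omega : 'I_d -> R) (l : nat).
Variable D : 'I_d -> direction R.

Definition product_space : topologicalType :=
  prod_topology (fun j : 'I_d => 'rV[R]_(dim (D j))).

Definition product_domain : set product_space :=
  [set x | forall j, domain (D j) (x j)].

Definition shift_index (lam : {ffun 'I_d -> nat}) (beta : {ffun 'I_d -> bool}) :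
  {ffun 'I_d -> nat} := [ffun j => (lam j + beta j)%N].

(* The d-fold sums over (u^(1), ..., u^(d)) and (k^(1), ..., k^(d)) are
   indexed by dependent finite functions of the direction j. *)
Definition multilevel (f : product_space -> R) (x : product_space) : R :=
  \sum_(lam \in surplus_set hd omega l)
  \sum_(beta : {ffun 'I_d -> bool} |
        shift_index lam beta \in index_set hd omega l%:R)
  \sum_(u : {dffun forall j : 'I_d, {set 'I_(lam j)}} |
        [forall j, u j != finset.set0])
    (-1) ^+ ((\sum_(j < d) beta j) + d + (\sum_(j < d) #|u j|)) *
    \sum_(k : {dffun forall j : 'I_d, multi_index (D j) (u j)})
      f (fun j => site (k j ord0)) *
      (\prod_(j < d) acoef (k j)) *
      \prod_(j < d) chi (k j ord_max) (x j).

End Operator.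

Arguments product_space {R d} D.
Arguments product_domain {R d} D _.
Arguments xi {R} D L i m y.

(* Main.v *)
(* In one direction, a term of the operator attached to u and k is (up to sign)
   an alternating product alpha^T r alpha^T r ... alpha^T r.  Summing over
   k_2, ..., k_n turns it into the entry k_1 of A_{u_1} P_u r_{u_n}(x), and
   summing over the sets u with prescribed first element i and largest element
   m turns it into the entry k_1 of xi_{i,m}(x).  Since f sees only
   (u_1, k_1), distributivity of the product over the directions reduces the
   theorem to this.  The blocks S_{i,m}, defined from subsets of
   {1, ..., level_max}, involve only subsets of {1, ..., m}; this is where
   lambda_j <= level_max is used. *)

Require Import Defs.
From mathcomp Require Import all_boot all_order all_algebra.
From mathcomp Require Import all_classical all_reals all_analysis.
Import Order.TTheory GRing.Theory Num.Theory.
Import numFieldNormedType.Exports.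
Local Open Scope classical_set_scope.
Local Open Scope ring_scope.

(** * Sums over dependent finite functions *)

Section DependentSums.
Context {R : comNzRingType} {I : finType}.

(** Extending each [g i] by 0 outside [Q i] absorbs the predicates, since one failing coordinate
    kills the product. The rest is [bigA_distr_big_dep], transported from [fprod] to [dffun]. *)
Lemma big_distr_dffun (T : I -> finType) (Q : forall i, pred (T i))
    (g : forall i, T i -> R) :
  \prod_i \sum_(t : T i | Q i t) g i t =
  \sum_(h : {dffun forall i, T i} | [forall i, Q i (h i)]) \prod_i g i (h i).
Proof.
pose g0 i : {ffun T i -> R} := [ffun t => if Q i t then g i t else 0].
transitivity (\prod_i \sum_(t : T i) g0 i t).
  apply: eq_bigr => i _; rewrite big_mkcond.
  by apply: eq_bigr => t _; rewrite ffunE.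
transitivity (\sum_(h : {dffun forall i, T i}) \prod_i g0 i (h i)); last first.
  rewrite [RHS]big_mkcond; apply: eq_bigr => h _.
  case: ifPn => [/forallP Qh|].
    by apply: eq_bigr => i _; rewrite ffunE Qh.
  by case/forallPn => i /negPf Qi; rewrite (bigD1 i) //= ffunE Qi mul0r.
under eq_bigr do rewrite (big_tag (fun i => g0 i)).
rewrite bigA_distr_big_dep -big_fprod.
rewrite [RHS](reindex (@dffun_of_fprod _ T)); last first.
  exact/onW_bij/dffun_of_fprod_bij.
apply: eq_bigr => h _; apply: eq_bigr => i _.
by congr (g0 i _); rewrite /dffun_of_fprod ffunE.
Qed.

(** The relation [r] assigns a single [s] to each [t] satisfying [Q], so a one-term sum over [s] can
    be inserted. Exchanging the sums and distributing leaves one fibre sum per coordinate. *)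
Lemma sum_fibre (T S : I -> finType) (Q : forall i, pred (T i))
    (r : forall i, T i -> pred (S i))
    (rP : forall i t, Q i t -> exists s, r i t =1 pred1 s)
    (g : forall i, T i -> R)
    (F : {dffun forall i, T i} -> R) (G : {dffun forall i, S i} -> R)
    (FG : forall (h : {dffun forall i, T i}) (s : {dffun forall i, S i}),
      (forall i, Q i (h i)) -> (forall i, r i (h i) (s i)) ->
      F h = G s) :
  \sum_(h : {dffun forall i, T i} | [forall i, Q i (h i)])
    F h * \prod_i g i (h i) =
  \sum_(s : {dffun forall i, S i})
    G s * \prod_i \sum_(t | Q i t && r i t (s i)) g i t.
Proof.
transitivity (\sum_(h : {dffun forall i, T i} | [forall i, Q i (h i)])
   \sum_(s : {dffun forall i, S i} | [forall i, r i (h i) (s i)])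
     G s * \prod_i g i (h i)).
  apply: eq_bigr => h /forallP Qh.
  have [s0 s0P] : exists s0 : {dffun forall i, S i},
      forall i, r i (h i) =1 pred1 (s0 i).
    have /all_sig[s0 s0P] i := cid (rP i _ (Qh i)).
    by exists [ffun i => s0 i] => i; rewrite ffunE.
  rewrite (big_pred1 s0) => [|s].
    by rewrite (FG h s0) // => i; rewrite s0P /=.
  apply/forallP/eqP => [e|-> i]; last by rewrite s0P /=.
  by apply/ffunP => i; apply/eqP; rewrite -[_ == _]s0P.
rewrite (exchange_big_dep xpredT) //=; apply: eq_bigr => s _.
rewrite big_distr_dffun mulr_sumr; apply: eq_bigl => h.
apply/andP/forallP => [[/forallP a /forallP b] i|a]; first by rewrite a b.
by split; apply/forallP => i; case/andP: (a i).
Qed.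

Lemma sum_tagged_dffun (T : I -> finType) (K : forall i, T i -> finType)
    (P : forall i, pred (T i)) (F : (forall i, {t : T i & K i t}) -> R) :
  \sum_(u : {dffun forall i, T i} | [forall i, P i (u i)])
   \sum_(k : {dffun forall i, K i (u i)}) F (fun i => Tagged (K i) (k i)) =
  \sum_(h : {dffun forall i, {t : T i & K i t}} | [forall i, P i (tag (h i))])
    F h.
Proof.
pose A := {u : {dffun forall i, T i} & {dffun forall i, K i (u i)}}.
pose B := {dffun forall i, {t : T i & K i t}}.
(* The first component evaluates to [tag (h i)] only through [ffunE], hence the transport of the
   second one. *)
pose split (h : B) : A :=
  Tagged (fun u : {dffun forall i, T i} => {dffun forall i, K i (u i)})
    [ffun i => eq_rect _ (fun t => K i t : Type) (tagged (h i)) _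
        (esym (ffunE (fun i => tag (h i)) i))].
pose merge (p : A) : B := [ffun i => Tagged (K i) (tagged p i)].
have splitK : cancel split merge.
  move=> h; apply/ffunP => i; rewrite /merge /split ffunE /=.
  apply: etrans (congr1 (fun z => Tagged (fun t => K i t) z) (ffunE _ _)) _.
  by case: _ / (esym _); case: (h i).
have merge_inj : injective merge.
  move=> [u k] [u' k'] e.
  have eu : u = u'.
    apply/ffunP => i.
    by have /(congr1 (fun h : B => tag (h i))) := e; rewrite !ffunE.
  subst u'; congr existT; apply/ffunP => i.
  have /(congr1 (fun h : B => h i)) := e; rewrite !ffunE /= => /eqP.
  by rewrite eq_Tagged /= => /eqP.
rewrite sig_big_dep (reindex merge) /=; last first.
  by exists split => x _; [exact: inj_can_sym|exact: splitK].
apply: eq_big => [p|p _].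
  by rewrite andbT; apply: eq_forallb => i; rewrite ffunE.
by congr F; apply: functional_extensionality_dep => i; rewrite ffunE.
Qed.

End DependentSums.

(** Splits off the last coordinate, for induction on path length. Indexing [T] by [nat] makes the
    types at [m] and at its widened ordinal convertible. *)
Lemma big_dffun_recr (R : nmodType) (n : nat) (T : nat -> finType)
    (F : {dffun forall m : 'I_n.+2, T m} -> R)
    (G : {dffun forall m : 'I_n.+1, T m} -> T n.+1 -> R)
    (FG : forall k, F k =
      G [ffun m : 'I_n.+1 => k (widen_ord (leqnSn _) m)] (k ord_max)) :
  \sum_k F k = \sum_k \sum_z G k z.
Proof.
(* An informative decision: the right case yields the equation along which the last value is
   transported. *)
have ltP (v : nat) : (v < n.+2)%N -> {(v < n.+1)%N} + {n.+1 = v}.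
  case: (ltnP v n.+1) => [h _|h1 h2]; first by left.
  by right; apply/eqP; rewrite eqn_leq h1 -ltnS h2.
pose ext (p : {dffun forall m : 'I_n.+1, T m} * T n.+1) :
    {dffun forall m : 'I_n.+2, T m} :=
  [ffun m : 'I_n.+2 => match ltP m (ltn_ord m) with
    | left h => p.1 (Ordinal h)
    | right e => eq_rect _ (fun v => T v : Type) p.2 _ e
    end].
pose res (k : {dffun forall m : 'I_n.+2, T m}) :
    {dffun forall m : 'I_n.+1, T m} * T n.+1 :=
  ([ffun m : 'I_n.+1 => k (widen_ord (leqnSn _) m)], k ord_max).
have extK : cancel ext res.
  move=> [k z]; congr pair; rewrite /ext.
    apply/ffunP => -[v hv]; rewrite !ffunE /=.
    case: (ltP _ _) => [h|e]; first by rewrite (bool_irrelevance h hv).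
    by exfalso; move: hv; rewrite -e ltnn.
  rewrite ffunE /=.
  case: (ltP _ _) => [h|e]; first by exfalso; move: h; rewrite ltnn.
  by rewrite (eq_irrelevance e erefl).
have res_inj : injective res.
  move=> k k' [e1 e2]; apply/ffunP => -[v hv].
  have irr (hv' : (v < n.+2)%N) :
      k (Ordinal hv') = k' (Ordinal hv') -> k (Ordinal hv) = k' (Ordinal hv).
    by rewrite (bool_irrelevance hv' hv).
  case: (ltP v hv) => [h|e].
    by have /ffunP/(_ (Ordinal h)) := e1; rewrite !ffunE => /irr.
  by subst v; apply: irr e2.
rewrite pair_big /= (reindex res) /=.
  by apply: eq_bigr => k _; rewrite FG.
by exists ext => y _; [exact: inj_can_sym|exact: extK].
Qed.

(** * Sums over site indices as matrix products *)

Section Paths.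
Context {R : realType} (D : direction R).

Lemma alpha_mx_rvec (i : nat) (y : 'rV[R]_(Defs.dim D)) (k : 'I_(nsites D i)) :
  (alpha_mx D i *m rvec i y) k 0 = chi k y.
Proof.
rewrite -[RHS]/(((alpha k)^T *m rvec i y) 0 0) !mxE.
by apply: eq_bigr => j _; rewrite !mxE.
Qed.

(** Each product [(alpha k)^T *m rvec p y] is a 1 by 1 matrix, that is, the scalar [chi k y]. *)
Lemma transfer_mx_rvec (i p : nat) (y : 'rV[R]_(Defs.dim D)) :
  transfer_mx D i p *m rvec p y =
  \sum_(k < nsites D p) chi k y *: rvec i (site k).
Proof.
rewrite mulmx_suml; apply: eq_bigr => k _.
by rewrite -mulmxA [X in _ *m X]mx11_scalar mul_mx_scalar.
Qed.

Lemma chi_site_congr (i p : nat) (a a' : 'I_(nsites D i))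
    (b b' : 'I_(nsites D p)) :
  a = a' -> b = b' -> chi a (site b) = chi a' (site b').
Proof. by move=> -> ->. Qed.

(** Induction on the number of transfer matrices, peeling off the last one. The level sequence [lv]
    is arbitrary, so shortening a path does not change the set it comes from. *)
Lemma path_sum (lv : nat -> nat) (n : nat) (k1 : 'I_(nsites D (lv 0)))
    (y : 'rV[R]_(Defs.dim D)) :
  \sum_(k : {dffun forall m : 'I_n.+1, 'I_(nsites D (lv m))} | k ord0 == k1)
    (\prod_(m < n)
       chi (k (widen_ord (leqnSn _) m)) (site (k (lift ord0 m)))) *
    chi (k ord_max) y =
  (alpha_mx D (lv 0) *m
   mulmx_seq (s := fun m => nsites D (lv m))
     (fun m => transfer_mx D (lv m) (lv m.+1)) n *m rvec (lv n) y) k1 0.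
Proof.
have irr (n' : nat) (k : {dffun forall m : 'I_n', 'I_(nsites D (lv m))}) v
    (hv hv' : (v < n')%N) : k (Ordinal hv) = k (Ordinal hv').
  by rewrite (bool_irrelevance hv hv').
(* The point [y] stays general: the induction hypothesis is applied at the last site [site z]. *)
elim: n y => [|n IHn] y.
  have e0 (m : 'I_1) : 0%N = m by case: m => -[].
  pose k0 : {dffun forall m : 'I_1, 'I_(nsites D (lv m))} :=
    [ffun m : 'I_1 => eq_rect 0%N (fun v => 'I_(nsites D (lv v))) k1 m (e0 m)].
  have k00 : k0 ord0 = k1 by rewrite ffunE (eq_irrelevance (e0 ord0) erefl).
  rewrite (big_pred1 k0) => [|k].
    rewrite big_ord0 mul1r /= mulmx1 alpha_mx_rvec.
    have -> : k0 ord_max = k1 by rewrite -k00; exact: (irr 1%N k0 0%N).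
    by [].
  apply/eqP/eqP => [e|->]; last exact: k00.
  apply/ffunP => -[[|//] hv]; rewrite (irr _ k _ hv (ltn0Sn 0)).
  rewrite (irr _ k0 _ hv (ltn0Sn 0)); exact: (etrans e (esym k00)).
rewrite big_mkcond /=.
rewrite (@big_dffun_recr _ _ (fun m => 'I_(nsites D (lv m))) _ (fun k z =>
  (if k ord0 == k1 then (\prod_(m < n)
       chi (k (widen_ord (leqnSn _) m)) (site (k (lift ord0 m)))) *
    chi (k ord_max) (site z) else 0) * chi z y)); last first.
  move=> k; rewrite ffunE.
  have -> : k (widen_ord (leqnSn n.+1) ord0) = k ord0 by exact: (irr _ k).
  case: ifP => _; last by rewrite mul0r.
  congr (_ * _); rewrite big_ord_recr /=; congr (_ * _).
    by apply: eq_bigr => m _; apply: chi_site_congr;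
      rewrite ffunE; exact: (irr _ k).
  by apply: chi_site_congr; rewrite ?ffunE; exact: (irr _ k).
(* Both sides are now sums over the last site index [z] with the common factor [chi z y]. *)
rewrite exchange_big /= mulmxA -mulmxA transfer_mx_rvec mulmx_sumr summxE.
apply: eq_bigr => z _; rewrite -scalemxAr mxE mulrC -IHn.
rewrite [in RHS]big_mkcond mulr_suml.
by apply: eq_bigr => k _.
Qed.

End Paths.

(** * Levels of ordered sets *)

Section OrderedSets.
Local Open Scope nat_scope.

Lemma sorted_levels (L : nat) (u : {set 'I_L}) :
  sorted ltn [seq (val p).+1 | p <- enum u].
Proof.
rewrite sorted_map {1}/enum_mem -enumT; apply: sorted_filter.
  by move=> a b c; exact: ltn_trans.
rewrite -(@sorted_map _ _ val (fun a b => a.+1 < b.+1)) val_enum_ord.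
exact: iota_ltn_sorted.
Qed.

Lemma size_levels (L : nat) (u : {set 'I_L}) :
  size [seq (val p).+1 | p <- enum u] = #|u|.
Proof. by rewrite size_map -cardE. Qed.

Lemma lev_le (L : nat) (u : {set 'I_L}) (i j : nat) :
  i <= j < #|u| -> lev u i <= lev u j.
Proof.
move=> /andP[ij ju]; apply: (sorted_leq_nth leq_trans leqnn) => //.
- by apply: sub_sorted (sorted_levels _ u) => a b; exact: ltnW.
- by rewrite inE size_levels (leq_ltn_trans ij).
- by rewrite inE size_levels.
Qed.

Lemma lev_bounds (L : nat) (u : {set 'I_L}) (i : nat) :
  i < #|u| -> 0 < lev u i <= L.
Proof.
rewrite -size_levels => /(mem_nth 0) /mapP[p _ e].
by rewrite /lev e /= ltn_ord.
Qed.

(** The inequality is strict because [p] stands for the level [p.+1]. *)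
Lemma le_lev_last (L : nat) (u : {set 'I_L}) (p : 'I_L) :
  p \in u -> p < lev u #|u|.-1.
Proof.
move=> pu; have : (val p).+1 \in [seq (val q).+1 | q <- enum u].
  by apply: map_f; rewrite mem_enum.
move=> /(nthP 0)[i]; rewrite size_levels => iu <-; apply: lev_le.
by rewrite -ltnS prednK (leq_ltn_trans _ iu) ?leqnn ?andbT //= iu.
Qed.

(** Both level lists are strictly increasing with the same members, hence equal. *)
Lemma lev_widen (n L : nat) (nL : n <= L) (u : {set 'I_n}) :
  lev (widen_ord nL @: u) = lev u.
Proof.
apply: functional_extensionality_dep => m; congr nth.
apply: (irr_sorted_eq ltn_trans ltnn (sorted_levels _ _) (sorted_levels _ _)).
move=> a; apply/mapP/mapP => -[p]; rewrite mem_enum.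
  by move=> /imsetP[q qu ->] ->; exists q; rewrite ?mem_enum.
move=> pu ->; exists (widen_ord nL p) => //.
by rewrite mem_enum; apply: imset_f.
Qed.

Lemma card_widen (n L : nat) (nL : n <= L) (u : {set 'I_n}) :
  #|widen_ord nL @: u| = #|u|.
Proof. by apply: card_imset => a b /(congr1 val) /= /val_inj. Qed.

End OrderedSets.

(** * Alternating path sums in one direction *)

Section Directions.
Context {R : realType} (D : direction R).

(** The sets [u] are grouped by their last level [m]; for [m <= n], the subsets of ['I_L] with last
    level [m] are exactly the widened subsets of ['I_n] with that last level. *)
Lemma sum_path_xi (n L : nat) (nL : (n <= L)%N) (i : nat)
    (k1 : 'I_(nsites D i)) (y : 'rV[R]_(Defs.dim D)) :
  \sum_(u : {set 'I_n} | (u != finset.set0) && (lev u 0 == i))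
    (-1) ^+ #|u| *
    (alpha_mx D i *m
     conform_mx (0 : 'M[R]_(nsites D i, nsites D (lev u #|u|.-1))) (path_mx D u)
     *m rvec (lev u #|u|.-1) y) k1 0 =
  \sum_(i <= m < n.+1) xi D L i m y k1 0.
Proof.
(* Level sequence, number of factors and last level are separate arguments, so each can be rewritten
   without breaking the types. *)
pose T (lv : nat -> nat) c p : R := (alpha_mx D i *m
  conform_mx (0 : 'M[R]_(nsites D i, nsites D p))
   (mulmx_seq (s := fun m => nsites D (lv m))
    (fun m => transfer_mx D (lv m) (lv m.+1)) c) *m rvec p y) k1 0.
have xiE m : xi D L i m y k1 0 = \sum_(v : {set 'I_L} |
    [&& v != finset.set0, lev v 0 == i & lev v #|v|.-1 == m])
    (-1) ^+ #|v| * T (lev v) #|v|.-1 m.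
  rewrite /Defs.xi /Smx mulmx_sumr mulmx_suml summxE; apply: eq_bigr => v _.
  by rewrite -scalemxAr -scalemxAl mxE.
under [RHS]eq_bigr do rewrite xiE.
rewrite (big_nat_widenl i 0) // big_mkord.
have last_lt (u : {set 'I_n}) : u != finset.set0 ->
    (lev u 0 <= lev u #|u|.-1 < n.+1)%N.
  rewrite -card_gt0 => u0; rewrite lev_le ?ltn_predL //=.
  by have /andP[] : (0 < lev u #|u|.-1 <= n)%N by rewrite lev_bounds ?ltn_predL.
(* [inord] never takes its default value here, as the last level is at most [n]. *)
rewrite (partition_big (fun u => inord (lev u #|u|.-1) : 'I_n.+1)
  (fun m : 'I_n.+1 => (i <= m)%N)) /=; last first.
  by move=> u /andP[/last_lt /andP[le lt] /eqP <-]; rewrite inordK.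
apply: eq_bigr => m im.
rewrite [RHS](reindex_onto (fun u : {set 'I_n} => widen_ord nL @: u)
   (fun v : {set 'I_L} => [set p | widen_ord nL p \in v]%SET)) /=; last first.
  move=> v /and3P[v0 _ /eqP lastv]; apply/setP => p; apply/imsetP/idP.
    by case=> q; rewrite inE => ? ->.
  move=> pv; have pn : (p < n)%N.
    by rewrite -ltnS (leq_trans _ (ltn_ord m)) // -lastv ltnS le_lev_last.
  have pE : p = widen_ord nL (Ordinal pn) by exact: val_inj.
  by exists (Ordinal pn); rewrite // inE -pE.
apply: eq_big => [u|u /andP[/andP[u0 _] /eqP <-]].
  have -> : [set p | widen_ord nL p \in widen_ord nL @: u]%SET = u.
    apply/setP => p; rewrite inE mem_imset //.
    by move=> a b /(congr1 val) /= /val_inj.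
  rewrite eqxx andbT lev_widen card_widen -!card_gt0 card_widen card_gt0.
  case: (boolP (u != finset.set0)) => //= /last_lt /andP[_ lt].
  by congr (_ && _); apply/eqP/eqP => [<-|->]; rewrite ?inordK // inord_val.
rewrite card_widen lev_widen inordK //.
by have /andP[] := last_lt u u0.
Qed.

Lemma sum_multi_index (L : nat) (u : {set 'I_L}) (i : nat)
    (k1 : 'I_(nsites D i)) (y : 'rV[R]_(Defs.dim D)) : lev u 0 = i ->
  \sum_(k : multi_index D u | val (k ord0) == val k1)
    acoef k * chi (k ord_max) y =
  (alpha_mx D i *m
   conform_mx (0 : 'M[R]_(nsites D i, nsites D (lev u #|u|.-1))) (path_mx D u)
   *m rvec (lev u #|u|.-1) y) k1 0.
Proof. by move=> e; subst i; rewrite conform_mx_id -path_sum. Qed.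

End Directions.

(** All terms of the weighted sum are nonnegative, so the [j]-th alone obeys the bound; divide by
    [omega j] and take the floor. *)
Lemma index_set_level_max (R : realType) (d : nat) (hd : (0 < d)%N)
    (omega : 'I_d -> R) (omega_gt0 : forall j, 0 < omega j) (l : nat)
    (lam : {ffun 'I_d -> nat}) (j : 'I_d) :
  index_set hd omega l%:R lam -> (lam j <= level_max hd omega l j)%N.
Proof.
move=> [lam_gt0 lam_le]; case E : (lam j) => [//|p].
have term_ge0 i : 0 <= ((lam i)%:R - 1) * omega i.
  by apply: mulr_ge0; rewrite ?subr_ge0 ?ler1n ?(ltW (omega_gt0 i)).
have ple : p%:R <= l%:R * omega_min hd omega / omega j.
  rewrite ler_pdivlMr //; apply: le_trans lam_le.
  by rewrite (bigD1 j) //= E -natr1 addrK lerDl; exact: sumr_ge0.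
by rewrite ltnS truncn_ge_nat // (le_trans _ ple).
Qed.

(** * Grouping by first level and first site *)

Section FirstSites.
Context {R : realType}.

(* The pair s = (q, k') stands for the level u_1 = q + 1 and the site index
   k_1 = k'.  The site indices compared have different types, hence [val]. *)
Definition starts_at {D : direction R} {n : nat}
    (t : {u : {set 'I_n} & multi_index D u})
    (s : {q : 'I_n & 'I_(nsites D q.+1)}) : bool :=
  (lev (tag t) 0 == (tag s).+1) && (val (tagged t ord0) == val (tagged s)).

Lemma starts_at_unique (D : direction R) (n : nat)
    (t : {u : {set 'I_n} & multi_index D u}) : tag t != finset.set0 ->
  exists s, starts_at t =1 pred1 s.
Proof.
case: t => u k; rewrite -card_gt0 /= => u0.
(* Levels are positive, so the first one is a successor; [cast_ord] then carries the first site
   index to it. *)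
have [q e] : exists q : 'I_n, lev u 0 = q.+1.
  have := lev_bounds n u 0 u0; case: (lev u 0) => // q /= qn.
  by exists (Ordinal qn).
exists (Tagged (fun q : 'I_n => 'I_(nsites D q.+1))
  (cast_ord (congr1 (nsites D) e) (k ord0))) => -[q' k'] /=.
rewrite /starts_at /=; apply/andP/eqP => [[/eqP lq /eqP kk]|].
  have qq : q' = q by apply/val_inj/succn_inj; rewrite -lq.
  by subst q'; congr existT; apply: val_inj; rewrite /= -kk.
move=> ekk; have /= qq := congr1 tag ekk; subst q'.
by move/eqP: ekk; rewrite eq_Tagged /= => /eqP ->; split; apply/eqP.
Qed.

Lemma site_val_inj (D : direction R) (i p : nat) (a : 'I_(nsites D i))
    (b : 'I_(nsites D p)) : i = p -> val a = val b -> site a = site b.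
Proof. by move=> e; subst p => /val_inj ->. Qed.

(** [starts_at] splits into a condition on the set and one on the site index, so the sum over pairs
    is iterated: [sum_multi_index] inside, [sum_path_xi] outside. *)
Lemma sum_starts_at (D : direction R) (n L : nat) (nL : (n <= L)%N)
    (s : {q : 'I_n & 'I_(nsites D q.+1)}) (y : 'rV[R]_(Defs.dim D)) :
  \sum_(t : {u : {set 'I_n} & multi_index D u} |
      (tag t != finset.set0) && starts_at t s)
    (-1) ^+ #|tag t| * (acoef (tagged t) * chi (tagged t ord_max) y) =
  \sum_((tag s).+1 <= m < n.+1) xi D L (tag s).+1 m y (tagged s) 0.
Proof.
rewrite -(sum_path_xi D n L nL).
under [RHS]eq_bigr => u /andP[_ /eqP e] do
  rewrite -(sum_multi_index _ _ _ _ _ _ e) mulr_sumr.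
by rewrite sig_big_dep; apply: eq_bigl => t; rewrite /starts_at andbA.
Qed.

Lemma sum_multilevel_term (d : nat) (D : 'I_d -> direction R)
    (f : product_space D -> R) (x : product_space D) (lam L : 'I_d -> nat)
    (lamL : forall j, (lam j <= L j)%N) :
  \sum_(u : {dffun forall j : 'I_d, {set 'I_(lam j)}} |
        [forall j, u j != finset.set0])
    (-1) ^+ (\sum_(j < d) #|u j|) *
    \sum_(k : {dffun forall j : 'I_d, multi_index (D j) (u j)})
      f (fun j => site (k j ord0)) *
      (\prod_(j < d) acoef (k j)) *
      \prod_(j < d) chi (k j ord_max) (x j) =
  \sum_(u : {dffun forall j : 'I_d, 'I_(lam j)})
  \sum_(k : {dffun forall j : 'I_d, 'I_(nsites (D j) (u j).+1)})
    f (fun j => site (k j)) *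
    \prod_(j < d)
      \sum_((u j).+1 <= m < (lam j).+1)
        xi (D j) (L j) (u j).+1 m (x j) (k j) 0.
Proof.
pose T j : finType := {u : {set 'I_(lam j)} & multi_index (D j) u}.
pose S j : finType := {q : 'I_(lam j) & 'I_(nsites (D j) q.+1)}.
pose g j (t : T j) :=
  (-1) ^+ #|tag t| * (acoef (tagged t) * chi (tagged t ord_max) (x j)).
pose F (h : forall j, T j) : R := f (fun j => site (tagged (h j) ord0)).
pose G (s : forall j, S j) : R := f (fun j => site (tagged (s j))).
(* Sets and multi-indices are packed into pairs, and the signs are distributed over the
   directions. *)
transitivity (\sum_(h : {dffun forall j, T j} |
    [forall j, tag (h j) != finset.set0]) F h * \prod_j g j (h j)).
  rewrite -(@sum_tagged_dffun _ _ (fun j => {set 'I_(lam j)} : finType)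
    (fun j u => multi_index (D j) u) (fun j u => u != finset.set0)
    (fun h => F h * \prod_j g j (h j))).
  apply: eq_bigr => u _; rewrite mulr_sumr; apply: eq_bigr => k _.
  by rewrite /g /= !big_split /= -prodrXr -mulrA [LHS]mulrCA.
rewrite (@sum_fibre _ _ T S (fun j t => tag t != finset.set0)
  (fun j t s => starts_at t s) _ _ _ G) => [|j t|h s _ hs]; last 2 first.
- exact: starts_at_unique.
- congr f; apply: functional_extensionality_dep => j.
  by have /andP[/eqP e /eqP] := hs j; exact: site_val_inj.
(* The pairs [s] are unpacked into first levels and first site indices. *)
pose H (s : forall j, S j) := G s * \prod_(j < d)
   \sum_((tag (s j)).+1 <= m < (lam j).+1)
     xi (D j) (L j) (tag (s j)).+1 m (x j) (tagged (s j)) 0.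
have := @sum_tagged_dffun _ _ (fun j => 'I_(lam j) : finType)
  (fun j q => 'I_(nsites (D j) q.+1) : finType) (fun _ _ => true) H.
rewrite (eq_bigl xpredT) => [|u]; last exact/forallP.
rewrite [in RHS](eq_bigl xpredT) => [e|s]; last exact/forallP.
apply: etrans (esym e); apply: eq_bigr => s _; congr (_ * _).
apply: eq_bigr => j _; exact: sum_starts_at.
Qed.

End FirstSites.

Theorem theorem3p8 (R : realType) (d : nat) (hd : (0 < d)%N)
  (omega : 'I_d -> R) (homega : forall j, 0 < omega j)
  (l : nat) (hl : (0 < l)%N)
  (D : 'I_d -> direction R)
  (hD : forall j, admissible (D j) (level_max hd omega l j))
  (f : product_space D -> R)
  (hf : {within product_domain D, continuous f})
  (x : product_space D) (hx : product_domain D x) :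
  multilevel hd omega l f x =
  \sum_(lam \in surplus_set hd omega l)
  \sum_(beta : {ffun 'I_d -> bool} |
        shift_index lam beta \in index_set hd omega l%:R)
    (-1) ^+ ((\sum_(j < d) beta j) + d) *
    \sum_(u : {dffun forall j : 'I_d, 'I_(lam j)})
    \sum_(k : {dffun forall j : 'I_d, 'I_(nsites (D j) (u j).+1)})
      f (fun j => site (k j)) *
      \prod_(j < d)
        \sum_((u j).+1 <= m < (lam j).+1)
          xi (D j) (level_max hd omega l j) (u j).+1 m (x j) (k j) 0.
Proof.
(* [lam_in] bounds each [lam j] by [level_max]; it remains to split the sign into its part in
   [beta], [d] and its part in [u]. *)
apply: eq_fsbigr => lam /set_mem[lam_in _]; apply: eq_bigr => beta _.
rewrite -(sum_multilevel_term _ _ _ _ _ _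
  (fun j => index_set_level_max _ _ hd omega homega l lam j lam_in)).
by rewrite mulr_sumr; apply: eq_bigr => u _; rewrite exprD mulrA.
Qed.
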